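(* Let $\rho_0$ and $\rho_1$ be the probability densities of a real observable $\omega$ supported on a connected domain $\Omega\subset\mathbb{R}$ under hypotheses $H_0$ and $H_1$ respectively. Define the cumulative ROC and the Neyman–Pearson ROC by $$TPR_{cum}(\tau)=\mathbb{P}_{\omega\sim\rho_0}[\omega<\tau],\quad FPR_{cum}(\tau)=\mathbb{P}_{\omega\sim\rho_1}[\omega<\tau],$$ $$TPR_{NP}(C)=\mathbb{P}_{\omega\sim\rho_0}[\rho_0(\omega)>C\rho_1(\omega)],\quad FPR_{NP}(C)=\mathbb{P}_{\omega\sim\rho_1}[\rho_0(\omega)>C\rho_1(\omega)].$$ Assume there exists a strictly increasing differentiable transformation $\Phi:\Omega\to\mathbb{R}$ such that $\Phi(\omega)\sim\mathcal{N}(\mu_0,\sigma_0^2)$ if $\omega\sim\rho_0$ and $\Phi(\omega)\sim\mathcal{N}(\mu_1,\sigma_1^2)$ if $\omega\sim\rho_1$, with $\mu_0<\mu_1$. Then: (1) If $\sigma_0=\sigma_1$, the cumulative ROC curve and the Neyman–Pearson ROC curve are identical and are given by $$TPR=\tfrac12-\tfrac12\,\mathrm{erf}\!\left(\frac{\mu_0-\mu_1}{\sqrt2\,\sigma_0}+\frac{\sigma_1}{\sigma_0}\,\mathrm{erf}^{-1}(1-2FPR)\right).$$ (2) The Neyman–Pearson ROC curve is a continuous function of $\sigma_0$ and $\sigma_1$ (including across $\sigma_0=\sigma_1$); thus when $\sigma_0$ is close to $\sigma_1$ the Neyman–Pearson ROC curve remains close to the cumulative ROC curve. (3) For arbitrary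 $\sigma_0,\sigma_1$, the Neyman–Pearson ROC is asymptotically equivalent in the low-$FPR$ regime to the curve in (1): writing $g(FPR)$ for the right-hand side of the formula in (1), $g(FPR_{NP}(C))/TPR_{NP}(C)\to 1$ as $C\to\infty$.
   Context: $\mathrm{erf}$ is the Gaussian error function and $\mathrm{erf}^{-1}$ its inverse. The cumulative ROC is the parametric curve $\tau\mapsto(FPR_{cum}(\tau),TPR_{cum}(\tau))$ and the Neyman–Pearson ROC is the parametric curve $C\mapsto(FPR_{NP}(C),TPR_{NP}(C))$.
   Formalization: In (3) the limit is taken only along C with FPR_NP(C)>0: if σ0<σ1, both rates vanish for large C, the ratio is 0/0 and nothing is claimed. In (1) the curves are compared for C>0 and 0<FPR<1. The closing ''thus … remains close'' of (2) is not stated separately. *)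

(* Defs.v *)
From HB Require Import structures.
From mathcomp Require Import all_boot all_order all_algebra.
From mathcomp Require Import all_classical all_reals all_analysis.
Set Implicit Arguments. Unset Strict Implicit. Unset Printing Implicit Defensive.
Import Order.TTheory GRing.Theory Num.Theory Num.Def.
Import numFieldNormedType.Exports.
Local Open Scope classical_set_scope.
Local Open Scope ring_scope.

Section defs.
Context {R : realType}.

Definition erf (x : R) : R :=
  2 / Num.sqrt pi *
  (if 0 <= x then Rintegral lebesgue_measure `[0, x] (fun t => expR (- t ^+ 2))
   else - Rintegral lebesgue_measure `[x, 0] (fun t => expR (- t ^+ 2))).

(* Inverse error function: the (unique, for -1 < y < 1) x with erf x = y. *)
Definition erfinv (y : R) : R := xget 0 [set x | erf x = y].

Definition prob (rho : R -> R) (A : set R) : R :=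
  fine (\int[lebesgue_measure]_(x in A) (rho x)%:E)%E.

Definition density_on (Omega : set R) (rho : R -> R) : Prop :=
  [/\ measurable_fun setT rho, (forall x, 0 <= rho x),
      (forall x, ~ Omega x -> rho x = 0)
    & (\int[lebesgue_measure]_x (rho x)%:E = 1)%E].

Definition TPR_cum (rho0 : R -> R) (tau : R) : R := prob rho0 [set w | w < tau].
Definition FPR_cum (rho1 : R -> R) (tau : R) : R := prob rho1 [set w | w < tau].

Definition NP_region (rho0 rho1 : R -> R) (C : R) : set R :=
  [set w | rho0 w > C * rho1 w].
Definition TPR_NP (rho0 rho1 : R -> R) (C : R) : R := prob rho0 (NP_region rho0 rho1 C).
Definition FPR_NP (rho0 rho1 : R -> R) (C : R) : R := prob rho1 (NP_region rho0 rho1 C).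

Definition roc_formula (mu0 sigma0 mu1 sigma1 : R) (fpr : R) : R :=
  1 / 2 - 1 / 2 * erf ((mu0 - mu1) / (Num.sqrt 2 * sigma0)
                        + sigma1 / sigma0 * erfinv (1 - 2 * fpr)).

End defs.

(* Main.v *)
Require Import Defs.
From HB Require Import structures.
From mathcomp Require Import all_boot all_order all_algebra ring lra.
From mathcomp Require Import all_classical all_reals all_analysis.
From mathcomp Require Import measurable_realfun.
Import Order.TTheory GRing.Theory Num.Theory Num.Def.
Import numFieldNormedType.Exports.
Local Open Scope classical_set_scope.
Local Open Scope ring_scope.

(* [Phi] is a bijection from [Omega] onto the line, so the law of each Borel
   subset of [Omega] is that of a Borel set of the line, and the Neyman-Pearson
   region of (rho0, rho1) corresponds, up to a null set, to the one of the two
   Gaussians, because both are optimal. For Gaussians the region is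
   [log C + const < quadratic in t]: a half-line if the variances agree; empty
   for large [C] if [sigma0 < sigma1]; and the complement of [m - r, m + r] with
   [r -> +oo] if [sigma1 < sigma0]. In the last case [m > mu1 > mu0], hence the
   right tail is negligible before the left one under both laws, and dropping it
   from both rates leaves exactly the curve of the equal-variance formula.
   Continuity is dominated convergence, as [pdf0 = C pdf1] has at most two
   solutions. *)

Set Implicit Arguments.
Unset Strict Implicit.
Unset Printing Implicit Defensive.

(** * Distribution function of the centred normal law of variance 1/2 *)

Section gauss_cdf.
Context {R : realType}.
Implicit Types (x y m s t : R).
Local Notation mu := (@lebesgue_measure R).

(** The variance 1/2 makes [erf x] equal to [2 * gauss_cdf x - 1] without rescaling. *)
Definition gauss_cdf x : R :=
  Rintegral mu `]-oo, x] gauss_fun / Num.sqrt pi.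

Lemma integrable_gauss (A : set R) : measurable A ->
  mu.-integrable A (EFin \o @gauss_fun R).
Proof.
by move=> mA; apply: integrableS (integrableT_gauss) => //.
Qed.

Lemma sqrt_pi_gt0 : 0 < Num.sqrt (pi : R).
Proof. by rewrite sqrtr_gt0 pi_gt0. Qed.

Lemma is_derive_gauss_cdf x :
  is_derive x 1 gauss_cdf (gauss_fun x / Num.sqrt pi).
Proof.
have h : x < x + 1 by rewrite ltrDl.
have [d e] := continuous_FTC1 h (integrable_gauss (measurable_itv `]-oo, x + 1]))
  (ltNyr x) (@continuous_gauss_fun R x).
rewrite /gauss_cdf.
apply: is_derive_eq.
- apply: is_deriveM.
  apply: DeriveDef; [exact: d|].
  by rewrite -derive1E e.
by rewrite scaler0 add0r /= mulrC.
Qed.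

Lemma normal_prob_itvNyc m s t : 0 < s ->
  normal_prob m s `]-oo, t] = (gauss_cdf ((t - m) / (Num.sqrt 2 * s)))%:E.
Proof.
move=> s0.
have sn0 : s != 0 by rewrite gt_eqF.
have c0 : 0 < (Num.sqrt 2 * s)^-1 by rewrite invr_gt0 mulr_gt0// sqrtr_gt0.
(* This affine map brings the variance [s ^+ 2] to 1/2; its constant derivative is the factor
   between [normal_peak s] and the inverse of [Num.sqrt pi]. *)
pose F x : R := (x - m) / (Num.sqrt 2 * s).
have dF x : is_derive x 1 F (Num.sqrt 2 * s)^-1.
  by apply: is_derive_eq; rewrite subr0 scaler0 add0r /GRing.scale/= mulr1.
have F'E : F^`()%classic = cst (Num.sqrt 2 * s)^-1.
  by apply/funext => x; rewrite derive1E derive_val.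
have cF : continuous F.
  by move=> x; apply/differentiable_continuous/derivable1_diffP.
have H : (\int[mu]_(x in `]-oo, F t]) (gauss_fun x)%:E =
  \int[mu]_(x in `]-oo, t]) (((gauss_fun \o F) * F^`()%classic) x)%:E)%E.
apply: increasing_ge0_integration_by_substitutionNy.
- by move=> x y _ _ xy; rewrite /F ltr_pM2r// ltrD2r.
- by rewrite F'E => ? _; exact: cvg_cst.
- by rewrite F'E; exact: is_cvg_cst.
- by rewrite F'E; exact: cvg_cst.
- split; first by move=> x _.
  by apply: cvg_at_left_filter; exact: cF.
- apply/gt0_cvgMlNy => //; exact: cvg_addrr_Ny.
- by apply: continuous_subspaceT; exact: continuous_gauss_fun.
- by move=> *; exact: gauss_fun_ge0.
rewrite /gauss_cdf /Rintegral -/(F t).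
rewrite -[X in (_ * X)%:E]/(fine (Num.sqrt pi)^-1%:E) -fineM//; last first.
  by apply: integrable_fin_num => //; exact: integrable_gauss.
rewrite H muleC -ge0_integralZl_EFin//; first last.
- apply/measurable_EFinP/measurable_funTS; rewrite F'E.
  apply: measurable_funM => //.
  apply: measurableT_comp; first exact: measurable_gauss_fun.
  exact: continuous_measurable_fun.
- by move=> x _; rewrite lee_fin F'E mulr_ge0 ?gauss_fun_ge0// ltW.
have -> : normal_prob m s `]-oo, t] = (fine (normal_prob m s `]-oo, t]))%:E.
  by rewrite fineK// fin_num_measure.
congr (fine _)%:E; apply: eq_integral => x _; rewrite -EFinM normal_pdfE// F'E /=.
rewrite mulrCA mulrC; congr (_ * _)%:E.
  rewrite /gauss_fun /normal_fun; congr expR.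
  rewrite /F expr_div_n exprMn sqr_sqrtr// mulNr; congr (- (_ / _)).
  by rewrite mulr_natl.
rewrite /normal_peak -invfM; congr _^-1.
have -> : s ^+ 2 * pi *+ 2 = pi * 2 * s ^+ 2 :> R by ring.
rewrite sqrtrM ?mulr_ge0 ?pi_ge0// sqrtr_sqr gtr0_norm// sqrtrM ?pi_ge0//.
by rewrite mulrA.
Qed.

Lemma normal_prob_itvNyo m s t : 0 < s ->
  normal_prob m s `]-oo, t[ = (gauss_cdf ((t - m) / (Num.sqrt 2 * s)))%:E.
Proof.
move=> s0; rewrite -normal_prob_itvNyc// /normal_prob integral_itv_bndo_bndc//.
by apply/measurable_EFinP/measurable_funTS; exact: measurable_normal_pdf.
Qed.

Lemma normal_prob_gauss_cdf x :
  normal_prob 0 (Num.sqrt 2)^-1 `]-oo, x] = (gauss_cdf x)%:E.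
Proof.
have s0 : 0 < Num.sqrt (2 : R) by rewrite sqrtr_gt0.
by rewrite normal_prob_itvNyc ?invr_gt0// divff ?gt_eqF// divr1 subr0.
Qed.

Lemma gauss_cdfN x : gauss_cdf (- x) = 1 - gauss_cdf x.
Proof.
have pi0 := sqrt_pi_gt0.
have H : Rintegral mu `]-oo, - x] gauss_fun = Rintegral mu `[x, +oo[ gauss_fun.
  rewrite /Rintegral ge0_integration_by_substitutionNy//; last 2 first.
  - by apply: continuous_subspaceT; exact: continuous_gauss_fun.
  - by move=> *; exact: gauss_fun_ge0.
  congr fine; apply: eq_integral => y _; rewrite /= /gauss_fun.
  by rewrite sqrrN.
have T : Rintegral mu setT gauss_fun = Num.sqrt pi :> R.
  by rewrite /Rintegral integralT_gauss.
have : Rintegral mu setT gauss_fun =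
    Rintegral mu `]-oo, x[ gauss_fun + Rintegral mu `[x, +oo[ gauss_fun.
  rewrite -Rintegral_setU//.
  - by rewrite -setCitvr setvU.
  - apply: integrable_gauss; exact: measurableU.
  - by rewrite -setCitvr; exact/disj_setPCr.
rewrite T Rintegral_itv_bndo_bndc; last exact: integrable_gauss.
rewrite /gauss_cdf H => E.
apply: (@mulIf _ (Num.sqrt pi)); first by rewrite gt_eqF.
by rewrite mulrBl !divfK ?gt_eqF// mul1r {1}E; ring.
Qed.

(** Both branches of [erf] come from increments of [gauss_cdf] between [x] and 0, where its value is
    1/2 by symmetry. *)
Lemma erfE x : erf x = 2 * gauss_cdf x - 1.
Proof.
have pi0 := sqrt_pi_gt0.
have g0 : gauss_cdf 0 = 1/2 by have := gauss_cdfN 0; rewrite oppr0; lra.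
have D (a b : R) : a <= b ->
    Rintegral mu `[a, b] gauss_fun = Num.sqrt pi * (gauss_cdf b - gauss_cdf a).
  move=> ab.
  rewrite -Rintegral_itv_obnd_cbnd; last exact: integrable_gauss.
  rewrite -(@Rintegral_itvB _ _ -oo%O)//; last exact: integrable_gauss.
  rewrite /gauss_cdf; field.
  by rewrite gt_eqF.
rewrite /erf -[fun t => expR (- t ^+ 2)]/(@gauss_fun R); case: ifPn => x0.
  by rewrite D// g0; field; rewrite gt_eqF.
rewrite D; last by rewrite ltW// ltNge.
by rewrite g0; field; rewrite gt_eqF.
Qed.

Lemma continuous_gauss_cdf : continuous gauss_cdf.
Proof.
move=> x; apply/differentiable_continuous/derivable1_diffP.
by have [] := is_derive_gauss_cdf x.
Qed.

Lemma gauss_cdf_lt x y : x < y -> gauss_cdf x < gauss_cdf y.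
Proof.
move=> xy.
have [|c _ e] := MVT xy (fun z _ => is_derive_gauss_cdf z).
  apply: continuous_subspaceT; exact: continuous_gauss_cdf.
by rewrite -subr_gt0 e !mulr_gt0 ?subr_gt0 ?invr_gt0 ?sqrt_pi_gt0 ?expR_gt0.
Qed.

End gauss_cdf.

(** * Limit, inversion and elementary tail bounds *)

Section gauss_cdf_bounds.
Context {R : realType}.
Implicit Types (x y z m s t p : R).
Lemma cvg_gauss_cdfNy : gauss_cdf x @[x --> -oo] --> (0 : R).
Proof.
have mid : @measurable_fun _ _ (measurableTypeR R) R setT idfun.
  exact: measurable_id.
pose X : {RV (normal_prob 0 (Num.sqrt 2)^-1 : probability (measurableTypeR R) R)
  >-> R} := @mfun_Sub _ _ (measurableTypeR R) R _ (mem_set mid).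
have cX r : cdf X r = (gauss_cdf r)%:E by rewrite -normal_prob_gauss_cdf.
have := cvg_cdfNy0 X; rewrite (_ : cdf X = EFin \o gauss_cdf); last exact/funext.
move=> H. exact: (fine_cvg H).
Qed.

 Lemma gauss_cdf_gt0 x : 0 < gauss_cdf x.
Proof.
have h y : 0 <= gauss_cdf y.
  rewrite mulr_ge0 ?invr_ge0 ?sqrtr_ge0//; apply: Rintegral_ge0 => z _.
  exact: gauss_fun_ge0.
by apply: (le_lt_trans (h (x - 1))); apply: gauss_cdf_lt; rewrite ltrBlDr ltrDl.
Qed.

Lemma gauss_cdf_lt1 x : gauss_cdf x < 1.
Proof. by have := gauss_cdf_gt0 (- x); rewrite gauss_cdfN subr_gt0. Qed.

Lemma gauss_cdf_le x y : x <= y -> gauss_cdf x <= gauss_cdf y.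
Proof.
by rewrite le_eqVlt => /predU1P[->//|xy]; apply/ltW/gauss_cdf_lt.
Qed.

Lemma ltr_gauss_cdf x y : (gauss_cdf x < gauss_cdf y) = (x < y).
Proof.
by apply: leW_mono; apply: le_mono; exact: gauss_cdf_lt.
Qed.

Lemma gauss_cdf_small m p : 0 < p -> exists2 x, x <= m & gauss_cdf x < p.
Proof.
move=> p0; have /cvgr_lt /(_ _ p0) [M [_ HM]] := cvg_gauss_cdfNy.
exists (minr m (M - 1)); first by rewrite ge_min lexx.
by apply: HM; rewrite gt_min ltrBlDr ltrDl ltr01 orbT.
Qed.

Lemma gauss_cdf_surj p : 0 < p < 1 -> exists x, gauss_cdf x = p.
Proof.
move=> /andP[p0 p1].
have [a a0 ap] := gauss_cdf_small 0 p0.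
have [b b0 bp] : exists2 b, 0 <= b & p < gauss_cdf b.
  have [b b0 bp] := @gauss_cdf_small 0 (1 - p) ltac:(by rewrite subr_gt0).
  exists (- b); first by rewrite oppr_ge0.
  by rewrite gauss_cdfN; lra.
have [//||c _ <-] := @IVT R gauss_cdf a b p (le_trans a0 b0); last by exists c.
- by apply: continuous_subspaceT; exact: continuous_gauss_cdf.
- by rewrite ge_min (ltW ap)/= le_max (ltW bp) orbT.
Qed.

Lemma erfinvK z : erfinv (1 - 2 * gauss_cdf z) = - z.
Proof.
have E : erf (- z) = 1 - 2 * gauss_cdf z by rewrite erfE gauss_cdfN; ring.
(* The choice made by [xget] is forced: [- z] is a preimage, which excludes the default value, and
   strict monotonicity makes it the only one. *)
rewrite /erfinv; case: xgetP => [x _ /= | /(_ (- z))]; last by rewrite /= E.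
rewrite erfE => e; have {}e : gauss_cdf x = gauss_cdf (- z).
  by rewrite gauss_cdfN; lra.
by case: (ltgtP x (- z)) => // /gauss_cdf_lt; rewrite e ltxx.
Qed.

(** Writing the false positive rate as [gauss_cdf z] cancels [erfinv] and leaves an affine change of
    argument; later uses of the formula go through this form. *)
Lemma roc_formulaE m0 s0 m1 s1 z : roc_formula m0 s0 m1 s1 (gauss_cdf z) =
  gauss_cdf (s1 / s0 * z - (m0 - m1) / (Num.sqrt 2 * s0)).
Proof.
rewrite /roc_formula erfinvK erfE.
rewrite mulrN -[X in gauss_cdf X]opprB gauss_cdfN; set w := gauss_cdf _; lra.
Qed.

(** The difference [f] of the two sides is nondecreasing up to [- (1/2)], and
    [f y >= - gauss_cdf y], which tends to 0 at [-oo]; a negative value of [f] is thus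
    impossible. *)
Lemma gauss_cdf_le_fun x : x <= - (1/2) -> gauss_cdf x <= gauss_fun x / Num.sqrt pi.
Proof.
move=> x0.
pose f y := gauss_fun y / Num.sqrt pi - gauss_cdf y.
have df y : is_derive y 1 f ((-2 * y - 1) * gauss_fun y / Num.sqrt pi).
  have := is_derive_gauss_cdf y.
  have H : is_derive y 1 gauss_fun (-2 * y * gauss_fun y).
    rewrite /gauss_fun; apply: is_derive_eq.
    rewrite /GRing.scale /=; ring.
  move=> H2; rewrite /f; apply: is_derive_eq.
  rewrite /GRing.scale /=; ring.
rewrite -subr_ge0 -/(f x) leNgt; apply/negP => fx0.
have [y yx Ky] : exists2 y, y <= x - 1 & gauss_cdf y < - f x.
  by apply: gauss_cdf_small; rewrite oppr_gt0.
have {}yx : y < x by rewrite (le_lt_trans yx)// ltrBlDr ltrDl.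
have [|c /[!in_itv]/= /andP[yc cx] e] := MVT yx (fun z _ => df z).
  apply: continuous_subspaceT => z.
  by apply/differentiable_continuous/derivable1_diffP; have [] := df z.
have : 0 <= f x - f y.
  rewrite e !mulr_ge0 ?gauss_fun_ge0 ?invr_ge0 ?sqrtr_ge0 ?subr_ge0 ?ltW//.
  lra.
have : 0 <= gauss_fun y / Num.sqrt pi.
  by rewrite mulr_ge0 ?gauss_fun_ge0// invr_ge0 sqrtr_ge0.
rewrite (_ : _ / _ = f y + gauss_cdf y); last by rewrite /f subrK.
move: Ky; lra.
Qed.

(** Mean value theorem, with a density that is nondecreasing on the negative half-line. *)
Lemma gauss_cdf_bound x y : x <= y -> y <= 0 ->
  (y - x) * (gauss_fun x / Num.sqrt pi) <= gauss_cdf y - gauss_cdf x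
    <= (y - x) * (gauss_fun y / Num.sqrt pi).
Proof.
move=> xy y0.
have [c /[!in_itv]/= /andP[xc cy] ->] :=
    MVT_segment xy (fun z _ => is_derive_gauss_cdf z)
      (continuous_subspaceT continuous_gauss_cdf).
have mono a b : a <= b -> b <= 0 -> gauss_fun a <= gauss_fun b :> R.
  move=> ab b0; rewrite /gauss_fun ler_expR lerN2 -sqrrN -[leRHS]sqrrN.
  by rewrite lerXn2r ?nnegrE; lra.
rewrite ![(y - x) * _]mulrC !ler_wpM2r ?subr_ge0 ?invr_ge0 ?sqrtr_ge0//.
- exact: mono.
- exact: mono (le_trans cy y0).
Qed.

End gauss_cdf_bounds.

(** * Asymptotics of Gaussian tails at [-oo] *)

Section gauss_cdf_tails.
Context {R : realType}.
Implicit Types (x y z u v d e m s t p : R).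

Lemma cvg_expRMlNy d : 0 < d -> expR (d * u) @[u --> -oo] --> (0 : R).
Proof.
move=> d0.
have H : - (d * u) @[u --> -oo] --> +oo.
  apply/cvgNry; rewrite (_ : *%R d = fun u => u * d); last exact/funext/mulrC.
  by apply: (gt0_cvgMlNy d0); exact: cvg_id.
have := cvg_comp _ _ H (@cvgr_expR R).
by apply: cvg_trans; apply: near_eq_cvg; near=> u; rewrite /= opprK.
Unshelve. all: end_near. Qed.

(* With [k] the derivative of [K = gauss_cdf], the mean value theorem on
   [x - h, x] gives [h * k (x - h) <= K x], to be compared with [K <= k]. *)
Lemma gauss_cdf_shift_bound x h d : x <= 0 -> 0 < h -> x - d <= - (1 / 2) ->
  gauss_cdf (x - d) / gauss_cdf x <= h^-1 * expR ((x - h) ^+ 2 - (x - d) ^+ 2).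
Proof.
move=> x0 h0 xd.
rewrite ler_pdivrMr ?gauss_cdf_gt0//.
apply: (le_trans (gauss_cdf_le_fun xd)).
have xh : x - h <= x by rewrite lerBlDr lerDl ltW.
have /andP[+ _] := gauss_cdf_bound xh x0.
have := gauss_cdf_gt0 (x - h) => K0 B.
have {}B : h * (gauss_fun (x - h) / Num.sqrt pi) <= gauss_cdf x by lra.
apply: le_trans (ler_wpM2l (_ : 0 <= h^-1 * expR ((x - h) ^+ 2 - (x - d) ^+ 2)) B); last first.
  by rewrite mulr_ge0 ?invr_ge0 ?expR_ge0// ltW.
have -> : gauss_fun (x - d) = expR ((x - h) ^+ 2 - (x - d) ^+ 2) * gauss_fun (x - h).
  by rewrite /gauss_fun -expRD; congr expR; ring.
rewrite le_eqVlt; apply/orP; left; apply/eqP; field.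
by rewrite !gt_eqF ?sqrt_pi_gt0.
Qed.

Lemma cvg_gauss_cdf_shift d : 0 < d ->
  gauss_cdf (x - d) / gauss_cdf x @[x --> -oo] --> (0 : R).
Proof.
move=> d0.
have lim : (d / 2)^-1 * expR (d * x) @[x --> -oo] --> (0 : R).
  rewrite -(mulr0 (d / 2)^-1); apply: cvgM; first exact: cvg_cst.
  exact: cvg_expRMlNy.
apply: squeeze_cvgr (cvg_cst 0) lim; near=> x; apply/andP; split.
  by rewrite divr_ge0// ltW// gauss_cdf_gt0.
have x0 : x <= 0 by near: x; exact: nbhs_ninfty_le.
have xd : x <= d - 1/2 by near: x; apply: nbhs_ninfty_le; exact: num_real.
(* With [h = d / 2] the exponent is [d * x - 3 / 4 * d ^+ 2], at most [d * x]. *)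
apply: (le_trans (gauss_cdf_shift_bound x0 (_ : 0 < d / 2) _)); rewrite ?divr_gt0//.
  lra.
rewrite ler_wpM2l ?invr_ge0 ?divr_ge0 ?(ltW d0)// ler_expR.
nra.
Unshelve. all: end_near. Qed.

(** With [k] the density and [D = exp (2 d u)], [gauss_cdf (u - d)] is at most
    [k (u - d) <= D * k u], while [gauss_cdf] gains at least [D * k u] on [[u, u + D]]. The bound
    [u <= -1] keeps [u + D] nonpositive, where [k] increases. *)
Lemma gauss_cdf_two_tails u d z : 0 < d -> u <= -1 ->
  gauss_cdf z = gauss_cdf u + gauss_cdf (u - d) ->
  u <= z <= u + expR (2 * d * u).
Proof.
move=> d0 u1 E.
have uz : u <= z.
  rewrite leNgt -ltr_gauss_cdf -leNgt E lerDl ltW//; exact: gauss_cdf_gt0.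
rewrite uz /= leNgt; apply/negP; rewrite -ltr_gauss_cdf E => K.
set D := expR (2 * d * u) in K.
have D0 : 0 < D by exact: expR_gt0.
have D1 : D <= 1 by rewrite expR_le1; nra.
have le1 : u <= u + D by rewrite lerDl ltW.
have le2 : u + D <= 0 by lra.
have /andP[+ _] := gauss_cdf_bound le1 le2.
have ud : u - d <= - (1/2) by lra.
have := gauss_cdf_le_fun ud.
have : gauss_fun (u - d) / Num.sqrt pi <= D * (gauss_fun u / Num.sqrt pi).
  rewrite mulrA ler_wpM2r ?invr_ge0 ?sqrtr_ge0// /D /gauss_fun -expRD ler_expR.
  nra.
have -> : u + D - u = D by ring.
lra.
Qed.

(* Since [0 <= z u - u <= D = exp (2 d u)], the relative error is at most
   [(s / h) exp (d u + c)] for the choice [h = d / (2 s)]. *)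
Lemma cvg_gauss_cdf_two_tails s (A : R) d (z : R -> R) : 0 < s -> 0 < d ->
  (\forall u \near -oo, gauss_cdf (z u) = gauss_cdf u + gauss_cdf (u - d)) ->
  gauss_cdf (s * z u - A) / gauss_cdf (s * u - A) @[u --> -oo] --> (1 : R).
Proof.
move=> s0 d0 zE.
pose h := d / (2 * s).
have h0 : 0 < h by rewrite divr_gt0// mulr_gt0.
have hs : 2 * h * s = d by rewrite /h; field; rewrite gt_eqF.
(* The summands are the bounds [e3], [e2], [e1] below and [h ^+ 2]: they control the expansion [e5]
   except for [- d * u] and a nonpositive square. *)
pose c := 2 * h * `|A| + 2 * s * `|A| + s ^+ 2 / d + h ^+ 2.
have lim : 1 + s / h * expR c * expR (d * u) @[u --> -oo] --> (1 : R).
  rewrite -[X in _ --> X]addr0 -[in X in _ --> X](mulr0 (s / h * expR c)).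
  apply: cvgD; first exact: cvg_cst.
  by apply: cvgM; [exact: cvg_cst|exact: cvg_expRMlNy].
apply: squeeze_cvgr (cvg_cst (1 : R)) lim; near=> u.
have u1 : u <= -1 by near: u; exact: nbhs_ninfty_le.
have uA : u <= A / s - 1 by near: u; apply: nbhs_ninfty_le; exact: num_real.
have zu : gauss_cdf (z u) = gauss_cdf u + gauss_cdf (u - d) by near: u.
have /andP[uz zD] := gauss_cdf_two_tails d0 u1 zu.
set D := expR (2 * d * u) in zD.
have D0 : 0 < D by exact: expR_gt0.
have D1 : D <= 1 by rewrite expR_le1; nra.
(* The inequality [t * exp (- t) <= 1] at [t = - (2 * d * u)]: [u * D] stays bounded although [u]
   does not. *)
have uD : - (2 * d * u) * D <= 1.
  have := expR_ge1Dx (- (2 * d * u)).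
  rewrite expRN -/D -(ler_pM2r D0) mulVf ?gt_eqF//; lra.
set v := s * u - A.
have K0 : 0 < gauss_cdf v := gauss_cdf_gt0 v.
have suA : s * u <= A - s.
  have : s * u <= s * (A / s - 1) by rewrite ler_pM2l.
  by rewrite mulrBr mulr1 mulrCA divff ?gt_eqF// mulr1.
have vD0 : v + s * D <= 0 by rewrite /v; nra.
have v0 : v <= 0 by rewrite /v; lra.
have vD : v <= v + s * D by rewrite lerDl mulr_ge0// ltW.
apply/andP; split.
  rewrite ler_pdivlMr// mul1r; apply: gauss_cdf_le.
  by rewrite lerB// ler_pM2l.
rewrite ler_pdivrMr//.
have szv : s * z u - A <= v + s * D.
  have : s * z u <= s * (u + D) by rewrite ler_pM2l.
  rewrite /v; lra.
apply: (le_trans (gauss_cdf_le szv)).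
have /andP[_] := gauss_cdf_bound vD vD0.
have vh : v - h <= v by rewrite lerBlDr lerDl ltW.
have /andP[+ _] := gauss_cdf_bound vh v0.
rewrite (_ : v - (v - h) = h); last by ring.
rewrite (_ : v + s * D - v = s * D); last by ring.
have := gauss_cdf_gt0 (v - h) => Kh L U.
have {}L : h * (gauss_fun (v - h) / Num.sqrt pi) <= gauss_cdf v by lra.
(* By the choice of [h] the quotient of the densities is at most [exp (c - d * u)], which consumes
   only half of the decay of [D]. *)
have E : D * gauss_fun (v + s * D) <= expR c * expR (d * u) * gauss_fun (v - h).
  rewrite /D /gauss_fun -!expRD ler_expR -/D.
  have A1 : A <= `|A| by rewrite ler_norm.
  have A2 : 0 <= `|A| by [].
  have e1 : - (2 * s ^+ 2 * u * D) <= s ^+ 2 / d.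
    rewrite ler_pdivlMr//.
    have -> : - (2 * s ^+ 2 * u * D) * d = s ^+ 2 * (- (2 * d * u) * D) by ring.
    by rewrite ler_piMr// sqr_ge0.
  have e2 : 2 * s * A * D <= 2 * s * `|A|.
    have : A * D <= `|A| by rewrite (le_trans (ler_wpM2r (ltW D0) A1))// ler_piMr.
    have := s0; nra.
  have e3 : 2 * h * A <= 2 * h * `|A| by rewrite ler_pM2l// mulr_gt0.
  have e4 : 0 <= (s * D) ^+ 2 by exact: sqr_ge0.
  have e5 : (v - h) ^+ 2 - (v + s * D) ^+ 2 = - (2 * s ^+ 2 * u * D) +
      2 * s * A * D - (s * D) ^+ 2 - d * u + 2 * h * A + h ^+ 2.
    rewrite -hs /v; ring.
  rewrite /c; lra.
have {}E : s * D * (gauss_fun (v + s * D) / Num.sqrt pi) <=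
    s / h * expR c * expR (d * u) * (h * (gauss_fun (v - h) / Num.sqrt pi)).
  have -> : s / h * expR c * expR (d * u) * (h * (gauss_fun (v - h) / Num.sqrt pi))
      = s / Num.sqrt pi * (expR c * expR (d * u) * gauss_fun (v - h)).
    by field; rewrite !gt_eqF ?sqrt_pi_gt0.
  have -> : s * D * (gauss_fun (v + s * D) / Num.sqrt pi) =
      s / Num.sqrt pi * (D * gauss_fun (v + s * D)).
    by ring.
  by rewrite ler_wpM2l// divr_ge0 ?sqrtr_ge0// ltW.
have P0 : 0 <= s / h * expR c * expR (d * u).
  by rewrite !mulr_ge0 ?invr_ge0 ?expR_ge0 ?(ltW h0) ?(ltW s0).
have := ler_wpM2l P0 L.
rewrite mulrDl mul1r; lra.
Unshelve. all: end_near. Qed.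

(** Here [u] and [v u] stand for the normalised left endpoint under laws 1 and 0, [u - d] and
    [v u - e] for the reflected right one. Numerator and denominator are both compared with
    [gauss_cdf (v u)]. *)
Lemma cvg_roc_formula_two_tails (m0 m1 s0 s1 : R) d e :
  0 < s0 -> 0 < s1 -> 0 < d -> 0 < e ->
  let v u := s1 / s0 * u - (m0 - m1) / (Num.sqrt 2 * s0) in
  roc_formula m0 s0 m1 s1 (gauss_cdf u + gauss_cdf (u - d)) /
    (gauss_cdf (v u) + gauss_cdf (v u - e)) @[u --> -oo] --> (1 : R).
Proof.
move=> s00 s10 d0 e0 v.
have s0' : 0 < s1 / s0 by rewrite divr_gt0.
(* For [u <= 0] the sum is below 1 because [gauss_cdf (u - d) < gauss_cdf u <= 1/2]; otherwise 0 is
   a dummy value. *)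
have zex u : exists z, u <= 0 -> gauss_cdf z = gauss_cdf u + gauss_cdf (u - d).
  have [u0|u0] := leP u 0; last by exists 0.
  have h0 : gauss_cdf (0 : R) = 1/2 by have := gauss_cdfN (0 : R); rewrite oppr0; lra.
  have le1 := gauss_cdf_le u0.
  have lt2 : gauss_cdf (u - d) < gauss_cdf u by rewrite gauss_cdf_lt// ltrBlDr ltrDl.
  have := gauss_cdf_gt0 u; have := gauss_cdf_gt0 (u - d) => p1 p2.
  have [|z zE] := @gauss_cdf_surj _ (gauss_cdf u + gauss_cdf (u - d)).
    by apply/andP; split; lra.
  by exists z.
have [z zE] := choice zex.
have z_near : \forall u \near -oo, gauss_cdf (z u) = gauss_cdf u + gauss_cdf (u - d).
  by near=> u; apply: zE; near: u; exact: nbhs_ninfty_le.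
have L1 := cvg_gauss_cdf_two_tails ((m0 - m1) / (Num.sqrt 2 * s0)) s0' d0 z_near.
have vNy : v u @[u --> -oo] --> -oo.
  rewrite /v; apply: cvg_comp (cvg_addrr_Ny _).
  rewrite (_ : *%R _ = fun u => u * (s1 / s0)); last exact/funext/mulrC.
  by apply: (gt0_cvgMlNy s0'); exact: cvg_id.
have L2 : 1 + gauss_cdf (v u - e) / gauss_cdf (v u) @[u --> -oo] --> (1 : R).
  rewrite -[X in _ --> X]addr0; apply: cvgD; first exact: cvg_cst.
  exact: cvg_comp vNy (cvg_gauss_cdf_shift e0).
have L3 : gauss_cdf (s1 / s0 * z u - (m0 - m1) / (Num.sqrt 2 * s0)) / gauss_cdf (v u) *
    (1 + gauss_cdf (v u - e) / gauss_cdf (v u))^-1 @[u --> -oo] --> (1 : R).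
  by have := cvgM L1 (cvgV (oner_neq0 R) L2); rewrite invr1 mulr1; exact.
move: L3; apply: cvg_trans; apply: near_eq_cvg; near=> u.
rewrite /= -zE; last by near: u; exact: nbhs_ninfty_le.
rewrite roc_formulaE -/(v u) /=.
set P := gauss_cdf (_ - _); have := gauss_cdf_gt0 (v u); have := gauss_cdf_gt0 (v u - e).
move=> p1 p2; field.
by rewrite !gt_eqF// addr_gt0.
Unshelve. all: end_near. Qed.

End gauss_cdf_tails.

(** * Neyman-Pearson optimality and its transfer through [Phi] *)

Section NP_region_transfer.
Context {R : realType}.
Local Notation mu := (@lebesgue_measure R).
Implicit Types (A B D E Omega : set R) (f g rho q Phi : R -> R).

(** The positive function [f - g] has integral zero on [A], so it vanishes almost everywhere there,
    although it vanishes nowhere on [A]; finiteness permits the subtraction. *)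
Lemma null_set_of_le_integral A f g : measurable A ->
  measurable_fun setT f -> measurable_fun setT g ->
  (forall x, A x -> 0 <= g x) -> (forall x, A x -> g x < f x) ->
  (\int[mu]_(x in A) (g x)%:E < +oo)%E ->
  (\int[mu]_(x in A) (f x)%:E <= \int[mu]_(x in A) (g x)%:E)%E ->
  mu A = 0%E.
Proof.
move=> mA mf mg g0 gf goo fg.
have mfg : measurable_fun A (fun x => (f x - g x)%:E).
  by apply/measurable_EFinP/measurable_funTS/measurable_funB.
have fg0 x : A x -> (0 <= (f x - g x)%:E)%E.
  by move=> Ax; rewrite lee_fin subr_ge0 ltW// gf.
have gfin : (\int[mu]_(x in A) (g x)%:E)%E \is a fin_num.
  by rewrite ge0_fin_numE// integral_ge0.
have fE : (\int[mu]_(x in A) (f x)%:E = \int[mu]_(x in A) (f x - g x)%:E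
    + \int[mu]_(x in A) (g x)%:E)%E.
  rewrite -ge0_integralD//; last exact/measurable_EFinP/measurable_funTS.
  by apply: eq_integral => x _; rewrite -EFinD subrK.
have I0 : (\int[mu]_(x in A) `|(f x - g x)%:E| = 0)%E.
  transitivity (\int[mu]_(x in A) (f x - g x)%:E)%E.
    by apply: eq_integral => x; rewrite inE => Ax; rewrite gee0_abs// fg0.
  apply/eqP; rewrite eq_le integral_ge0// andbT.
  by move: fg; rewrite fE -leeBrDr// subee.
have /(ae_eq_integral_abs mu mA mfg) [N [mN N0 NE]] := I0.
have AN : A `<=` N.
  move=> x Ax; apply: NE => /= /(_ Ax) [].
  by move/eqP; rewrite subr_eq0 gt_eqF// gf.
exact: (subset_measure0 (mA : measurable (A : set (measurableTypeR R))) mN AN N0).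
Qed.

Lemma measurable_NP_region (rho0 rho1 : R -> R) (C : R) :
  measurable_fun setT rho0 -> measurable_fun setT rho1 ->
  measurable (NP_region rho0 rho1 C).
Proof.
move=> mr0 mr1; rewrite /NP_region (_ : [set w | _] =
    (fun w => rho0 w - C * rho1 w) @^-1` `]0, +oo[).
  rewrite -[X in measurable X]setTI.
  apply: (@measurable_funB _ _ _ _ rho0 (fun w => C * rho1 w)) => //.
  exact: measurable_funM.
by apply/seteqP; split => w /=; rewrite in_itv/= andbT subr_gt0.
Qed.

(* Neyman-Pearson: the regions [rho0 > C rho1] and [q0 > C q1] are both optimal,
   so that they can only differ by a null set. *)
Lemma integral_NP_region Omega Phi (rho0 rho1 q0 q1 : R -> R) (C : R) B :
  0 < C -> measurable B ->
  (forall B, measurable B -> measurable (Omega `&` Phi @^-1` B)) ->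
  measurable_fun setT rho0 -> measurable_fun setT rho1 ->
  measurable_fun setT q0 -> measurable_fun setT q1 ->
  (forall x, 0 <= rho0 x) -> (forall x, 0 <= rho1 x) ->
  (forall x, 0 <= q0 x) -> (forall x, 0 <= q1 x) ->
  (\int[mu]_x (q0 x)%:E < +oo)%E -> (\int[mu]_x (q1 x)%:E < +oo)%E ->
  (forall B, measurable B -> (\int[mu]_(x in Omega `&` Phi @^-1` B) (rho0 x)%:E
    = \int[mu]_(x in B) (q0 x)%:E)%E) ->
  (forall B, measurable B -> (\int[mu]_(x in Omega `&` Phi @^-1` B) (rho1 x)%:E
    = \int[mu]_(x in B) (q1 x)%:E)%E) ->
  NP_region rho0 rho1 C = Omega `&` Phi @^-1` B ->
  (\int[mu]_(x in NP_region rho0 rho1 C) (rho0 x)%:E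
    = \int[mu]_(x in NP_region q0 q1 C) (q0 x)%:E)%E /\
  (\int[mu]_(x in NP_region rho0 rho1 C) (rho1 x)%:E
    = \int[mu]_(x in NP_region q0 q1 C) (q1 x)%:E)%E.
Proof.
move=> C0 mB mPhi mr0 mr1 mq0 mq1 r00 r10 q00 q10 q0oo q1oo I0 I1 DE.
set E := NP_region q0 q1 C.
have mE : measurable E by exact: measurable_NP_region.
have mEFin f A : measurable_fun setT f -> measurable_fun A (EFin \o f).
  by move=> mf; apply/measurable_EFinP/measurable_funTS.
have fin f A : measurable A -> measurable_fun setT f -> (forall x, 0 <= f x) ->
    (\int[mu]_x (f x)%:E < +oo)%E -> (\int[mu]_(x in A) (f x)%:E < +oo)%E.
  move=> mA mf f0; apply: le_lt_trans; apply: ge0_subset_integral => //.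
  - exact: mEFin.
  - by move=> x _; rewrite lee_fin.
have CE f A : measurable A -> measurable_fun setT f -> (forall x, 0 <= f x) ->
    (\int[mu]_(x in A) (C * f x)%:E = C%:E * \int[mu]_(x in A) (f x)%:E)%E.
  move=> mA mf f0; under eq_integral do rewrite EFinM.
  rewrite ge0_integralZl_EFin ?(ltW C0)//.
  - by move=> x _; rewrite lee_fin.
  - exact: mEFin.
have mCr1 : measurable_fun setT (fun x => C * rho1 x) by exact: measurable_funM.
have mCq1 : measurable_fun setT (fun x => C * q1 x) by exact: measurable_funM.
have mBE : measurable (B `\` E) by exact: measurableD.
have mEB : measurable (E `\` B) by exact: measurableD.
(* On this preimage [rho0 > C * rho1], whereas the integrals equal those of [q0] and [q1] over a set
   where [q0 <= C * q1]. *)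
have BE0 : mu (Omega `&` Phi @^-1` (B `\` E)) = 0%E.
  apply: (@null_set_of_le_integral _ rho0 (fun x => C * rho1 x)) => //.
  - exact: mPhi.
  - by move=> x _; rewrite mulr_ge0// ltW.
  - move=> x [Ox [Bx _]].
    by have : (Omega `&` Phi @^-1` B) x by []; rewrite -DE.
  - rewrite CE//; last exact: mPhi.
    rewrite I1// lte_mul_pinfty// ?lee_fin ?ltW//.
    exact: fin.
  - rewrite CE//; last exact: mPhi.
    rewrite I0// I1// -CE//; apply: ge0_le_integral => //.
    - by move=> x _; rewrite lee_fin.
    - exact: mEFin.
    - exact: mEFin.
    - by move=> x [_ /negP]; rewrite /E /NP_region /= -leNgt lee_fin.
(* The mirror argument: here [q0 > C * q1], but the preimage avoids the region, so
   [rho0 <= C * rho1] on it. *)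
have EB0 : mu (E `\` B) = 0%E.
  apply: (@null_set_of_le_integral _ q0 (fun x => C * q1 x)) => //.
  - by move=> x _; rewrite mulr_ge0// ltW.
  - by move=> x [].
  - rewrite CE// lte_mul_pinfty// ?lee_fin ?ltW//.
    exact: fin.
  - rewrite CE// -I1// -CE//; last exact: mPhi.
    rewrite -I0//; apply: ge0_le_integral => //.
    - exact: mPhi.
    - by move=> x _; rewrite lee_fin.
    - exact: mEFin.
    - exact: mEFin.
    - move=> x [Ox [_ NBx]]; rewrite lee_fin leNgt; apply/negP => Dx.
      have : NP_region rho0 rho1 C x by [].
      by rewrite DE => -[].
have main rho q : measurable_fun setT rho -> measurable_fun setT q ->
    (forall x, 0 <= q x) ->
    (forall B, measurable B -> (\int[mu]_(x in Omega `&` Phi @^-1` B) (rho x)%:E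
      = \int[mu]_(x in B) (q x)%:E)%E) ->
    (\int[mu]_(x in NP_region rho0 rho1 C) (rho x)%:E
      = \int[mu]_(x in E) (q x)%:E)%E.
  move=> mr mq q0' I.
  (* What has been shown null is the preimage of this set, not the set itself; the transport
     identity [I] carries the zero integral over. *)
  have zBE : (\int[mu]_(x in B `\` E) (q x)%:E = 0)%E.
    rewrite -I//; apply: null_set_integral => //.
    - exact: mPhi.
    - exact: mEFin.
  have zEB : (\int[mu]_(x in E `\` B) (q x)%:E = 0)%E.
    by apply: null_set_integral => //; exact: mEFin.
  have splitU A A' : measurable A -> measurable A' ->
      (\int[mu]_(x in A) (q x)%:E = \int[mu]_(x in A `&` A') (q x)%:E
       + \int[mu]_(x in A `\` A') (q x)%:E)%E.
    move=> mA mA'; rewrite -ge0_integral_setU//.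
    - by rewrite setUIDK.
    - exact: measurableI.
    - exact: measurableD.
    - exact: mEFin.
    - by move=> x _; rewrite lee_fin.
    - apply/disj_setPS => x [[_ ?] [_ ?]]; contradiction.
  by rewrite DE I// (splitU B E)// (splitU E B)// zBE zEB setIC.
by split; apply: main.
Qed.

End NP_region_transfer.

(** * Consequences of the change of variable by [Phi] *)

Definition transports_to_normal {R : realType} (Omega : set R) (Phi : R -> R)
    (rho : R -> R) (m s : R) := forall B, measurable B ->
  (\int[lebesgue_measure]_(x in Omega `&` Phi @^-1` B) (rho x)%:E)%E = normal_prob m s B.

Section transport.
Context {R : realType}.
Variables (Omega : set R) (Phi : R -> R).
Hypothesis openOmega : open Omega.
Hypothesis connectedOmega : connected Omega.
Hypothesis incrPhi : forall x y, Omega x -> Omega y -> x < y -> Phi x < Phi y.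
Hypothesis derivablePhi : forall x, Omega x -> derivable Phi x 1.

Local Notation mu := (@lebesgue_measure R).
Implicit Types (A B D : set R) (rho : R -> R) (m s : R).


Local Notation transports := (transports_to_normal Omega Phi).

Let measurableOmega : measurable Omega.
Proof. exact: open_measurable. Qed.

Lemma measurable_preimage_transport B : measurable B ->
  measurable (Omega `&` Phi @^-1` B).
Proof.
suff : measurable_fun Omega Phi by apply.
apply: open_continuous_measurable_fun => // x /[!inE] Ox.
by apply/differentiable_continuous/derivable1_diffP; exact: derivablePhi.
Qed.

(** A normal law gives []-oo, t]] a mass strictly between 0 and 1, so [Phi] takes values on both
    sides of [t]; the intermediate value theorem on the interval [Omega] concludes. *)
Lemma transport_surj rho m s t : 0 < s -> transports rho m s ->
  exists2 x, Omega x & Phi x = t.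
Proof.
move=> s0 H.
have full : normal_prob m s setT = 1%E by exact: probability_setT.
have [a Oa at_] : exists2 a, Omega a & Phi a <= t.
  apply: contrapT => nE.
  have e0 : Omega `&` Phi @^-1` `]-oo, t] = set0.
    rewrite -subset0 => x [Ox]; rewrite /= in_itv/= => xt.
    by apply: nE; exists x.
  have /esym := H `]-oo, t]%classic (measurable_itv _).
  rewrite e0 integral_set0 normal_prob_itvNyc// => -[] e.
  by have := gauss_cdf_gt0 ((t - m) / (Num.sqrt 2 * s)); rewrite e ltxx.
have [b Ob tb] : exists2 b, Omega b & t <= Phi b.
  apply: contrapT => nE.
  have e0 : Omega `&` Phi @^-1` `]-oo, t] = Omega `&` Phi @^-1` setT.
    apply/seteqP; split => x [Ox _]; split => //=.
    rewrite in_itv/= leNgt; apply/negP => /ltW tx.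
    by apply: nE; exists x.
  have := H `]-oo, t]%classic (measurable_itv _).
  rewrite e0 H// full normal_prob_itvNyc// => -[] e.
  by have := gauss_cdf_lt1 ((t - m) / (Num.sqrt 2 * s)); rewrite -e ltxx.
have ab : a <= b.
  rewrite leNgt; apply/negP => ba.
  have := incrPhi Ob Oa ba; rewrite ltNge => /negP; apply.
  exact: le_trans at_ tb.
have sub x : x \in `[a, b]%R -> Omega x.
  move/connected_intervalP : connectedOmega => intO.
  by rewrite in_itv/=; exact: intO.
have [|c cab <-] := @IVT R Phi a b t ab
    (derivable_within_continuous (fun x xab => derivablePhi (sub x xab))) _.
  by rewrite ge_min at_ le_max tb orbT.
by exists c => //; exact: sub.
Qed.

(** The inverse [g] of [Phi] given by surjectivity is monotone, hence Borel, and [B] is the preimage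
    of [D] under [g]. This puts a Neyman-Pearson region into the form required by
    [integral_NP_region]. *)
Lemma measurable_transport_preimage rho m s D : 0 < s -> transports rho m s ->
  measurable D -> D `<=` Omega ->
  exists2 B, measurable B & D = Omega `&` Phi @^-1` B.
Proof.
move=> s0 H mD DO.
have ex t : exists x, Omega x /\ Phi x = t.
  by have [x] := transport_surj t s0 H; exists x.
have [g gP] := choice ex.
have ndg : nondecreasing_fun g.
  move=> x y xy; rewrite leNgt; apply/negP => gyx.
  have := incrPhi (gP y).1 (gP x).1 gyx.
  by rewrite !(gP _).2 ltNge xy.
have gK x : Omega x -> g (Phi x) = x.
  move=> Ox; have [Ogx e] := gP (Phi x).
  case: (ltgtP (g (Phi x)) x) => // lt.
    by have := incrPhi Ogx Ox lt; rewrite e ltxx.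
  by have := incrPhi Ox Ogx lt; rewrite e ltxx.
exists (g @^-1` D).
  by rewrite -[X in measurable X]setTI; exact: nondecreasing_measurable.
apply/seteqP; split => x /=.
  by move=> Dx; split; [exact: DO|rewrite gK//; exact: DO].
by move=> [Ox]; rewrite gK.
Qed.

Lemma integral_support rho D : (forall x, ~ Omega x -> rho x = 0) ->
  (\int[mu]_(x in D) (rho x)%:E = \int[mu]_(x in Omega `&` D) (rho x)%:E)%E.
Proof.
move=> rho0; rewrite integral_mkcond [RHS]integral_mkcond.
apply: eq_integral => x _; rewrite /patch in_setI.
case: ifPn => xD; last by rewrite andbF.
case: ifPn => //; rewrite andbT notin_setE => /rho0 ->.
by [].
Qed.

Lemma integral_transport_itvNyo rho m s x : 0 < s -> transports rho m s ->
  (forall y, ~ Omega y -> rho y = 0) -> Omega x ->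
  (\int[mu]_(y in [set y | (y < x)%R]) (rho y)%:E)%E =
    (gauss_cdf ((Phi x - m) / (Num.sqrt 2 * s)))%:E.
Proof.
move=> s0 H rho0 Ox; rewrite -normal_prob_itvNyo// -H// integral_support//.
congr (integral _ _ _); apply/seteqP; split => y [Oy].
  by move=> yx; split => //; rewrite /= in_itv/=; exact: incrPhi.
rewrite /= in_itv/= => yx; split => //; rewrite /= ltNge le_eqVlt.
apply/negP => /predU1P[e|xy]; first by move: yx; rewrite e ltxx.
by have := lt_trans yx (incrPhi Ox Oy xy); rewrite ltxx.
Qed.

(** A point outside the interval [Omega] has all of [Omega] on one side, so as a threshold it yields
    only a corner of the ROC square. *)
Lemma integral_transport_itvNyo_notin rho m s x : transports rho m s ->
  (forall y, ~ Omega y -> rho y = 0) -> ~ Omega x ->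
  (\int[mu]_(y in [set y | (y < x)%R]) (rho y)%:E)%E \in [:: 0%E; 1%E].
Proof.
move=> H rho0 NOx; rewrite integral_support//.
have [E|/set0P[y [Oy /= yx]]] := eqVneq (Omega `&` [set y | (y < x)%R]) set0.
  by rewrite E integral_set0 inE eqxx.
have -> : Omega `&` [set y | (y < x)%R] = Omega `&` Phi @^-1` setT.
  apply/seteqP; split => z [Oz _] //; split => //=.
  rewrite ltNge; apply/negP => xz; apply: NOx.
  move/connected_intervalP : connectedOmega; apply; [exact: Oy|exact: Oz|].
  by rewrite (ltW yx).
by rewrite H// probability_setT !inE eqxx orbT.
Qed.

End transport.

(** * Neyman-Pearson regions of two normal laws *)

Section normal_regions.
Context {R : realType}.
Implicit Types (x y z u v d e m s t p C : R).

Lemma normal_prob_itvoy m s t : 0 < s ->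
  normal_prob m s `]t, +oo[ = (gauss_cdf (- ((t - m) / (Num.sqrt 2 * s))))%:E.
Proof.
move=> s0; rewrite gauss_cdfN EFinB -normal_prob_itvNyc//.
by rewrite -probability_setC//; congr (normal_prob _ _ _); rewrite setCitvl.
Qed.

Definition log_threshold s0 s1 C : R := ln (C * normal_peak s1 / normal_peak s0).

Lemma scaled_normal_pdfE s0 m1 s1 C t : 0 < s0 -> 0 < s1 -> 0 < C ->
  C * normal_pdf m1 s1 t = normal_peak s0 *
    expR (log_threshold s0 s1 C - (t - m1) ^+ 2 / (s1 ^+ 2 *+ 2)).
Proof.
move=> s00 s10 C0.
have p0 : 0 < normal_peak s0 by rewrite normal_peak_gt0// gt_eqF.
have p1 : 0 < normal_peak s1 by rewrite normal_peak_gt0// gt_eqF.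
have q0 : 0 < C * normal_peak s1 / normal_peak s0.
  by apply: divr_gt0 => //; exact: mulr_gt0.
rewrite normal_pdfE ?gt_eqF// expRD lnK ?posrE// /normal_fun mulNr; field.
by rewrite gt_eqF.
Qed.

Lemma NP_region_normalE m0 s0 m1 s1 C t : 0 < s0 -> 0 < s1 -> 0 < C ->
  NP_region (normal_pdf m0 s0) (normal_pdf m1 s1) C t <->
  log_threshold s0 s1 C <
    (t - m1) ^+ 2 / (s1 ^+ 2 *+ 2) - (t - m0) ^+ 2 / (s0 ^+ 2 *+ 2).
Proof.
move=> s00 s10 C0; rewrite /NP_region /= (scaled_normal_pdfE _ _ s00)//.
rewrite normal_pdfE ?gt_eqF// ltr_pM2l ?normal_peak_gt0 ?gt_eqF//.
rewrite ltr_expR mulNr.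
by split; lra.
Qed.

(** Taking logarithms gives an equation of degree at most two in [t]; it is not constant, since
    [a = 0] forces [b != 0] when the means differ. *)
Lemma normal_tie_finite m0 s0 m1 s1 C : 0 < s0 -> 0 < s1 -> 0 < C -> m0 != m1 ->
  finite_set [set t | normal_pdf m0 s0 t = C * normal_pdf m1 s1 t].
Proof.
move=> s00 s10 C0 m01.
set Z := [set t | _].
pose a := (s1 ^+ 2 *+ 2)^-1 - (s0 ^+ 2 *+ 2)^-1.
pose b := 2 * (m0 / (s0 ^+ 2 *+ 2) - m1 / (s1 ^+ 2 *+ 2)).
have q0 : (s0 ^+ 2 *+ 2) != 0 by rewrite -mulr_natr mulf_neq0 ?expf_neq0 ?gt_eqF.
have q1 : (s1 ^+ 2 *+ 2) != 0 by rewrite -mulr_natr mulf_neq0 ?expf_neq0 ?gt_eqF.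
have ab : a = 0 -> b != 0.
  move=> /eqP; rewrite subr_eq0 => /eqP e.
  by rewrite /b e -mulrBl !mulf_neq0 ?subr_eq0 ?invr_eq0.
have ZE t : Z t -> log_threshold s0 s1 C =
    a * t ^+ 2 + b * t + (m1 ^+ 2 / (s1 ^+ 2 *+ 2) - m0 ^+ 2 / (s0 ^+ 2 *+ 2)).
  rewrite /Z /= (scaled_normal_pdfE _ _ s00)// normal_pdfE ?gt_eqF//.
  move/(mulfI _) => /(_ (lt0r_neq0 (normal_peak_gt0 (lt0r_neq0 s00)))) /expR_inj.
  rewrite mulNr /a /b => e.
  rewrite -[LHS](subrK ((t - m1) ^+ 2 / (s1 ^+ 2 *+ 2))) -e.
  ring.
have [[t1 Zt1]|Z0] := pselect (exists t, Z t); last first.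
  rewrite (_ : Z = set0)//; apply/seteqP; split => // t Zt.
  by apply: Z0; exists t.
(* The second point is the other root by Vieta. If [a = 0] it is a junk value, harmless in an
   inclusion. *)
have sub : Z `<=` [set t1] `|` [set - b / a - t1].
  move=> t Zt; have := ZE t Zt; rewrite (ZE t1 Zt1) => /eqP.
  rewrite -subr_eq0 => /eqP e.
  have {}e : (t1 - t) * (a * (t1 + t) + b) = 0 by rewrite -[RHS]e; ring.
  move/eqP : e; rewrite mulf_eq0 => /orP[|/eqP e]; first by rewrite subr_eq0 => /eqP ->; left.
  have a0 : a != 0.
    apply/eqP => a0; move: e; rewrite a0 mul0r add0r.
    by move/eqP; apply/negP; exact: ab.
  right => /=; have -> : b = - (a * (t1 + t)) by lra.
  by field.
by apply: (sub_finite_set sub); rewrite finite_setU.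
Qed.

(** With equal variances the quadratic terms cancel, and the difference of exponents is affine and
    decreasing in [t]. *)
Lemma NP_region_normal_eq_variance m0 m1 s C : 0 < s -> 0 < C -> m0 < m1 ->
  NP_region (normal_pdf m0 s) (normal_pdf m1 s) C =
  `]-oo, (m0 + m1) / 2 - s ^+ 2 / (m1 - m0) * ln C[%classic.
Proof.
move=> s0 C0 m01; apply/seteqP.
have p0 : normal_peak s != 0 by rewrite gt_eqF// normal_peak_gt0// gt_eqF.
have E t : (t - m1) ^+ 2 / (s ^+ 2 *+ 2) - (t - m0) ^+ 2 / (s ^+ 2 *+ 2) =
   (m1 - m0) / s ^+ 2 * ((m0 + m1) / 2 - t).
  by field; rewrite gt_eqF.
have k0 : 0 < (m1 - m0) / s ^+ 2 by rewrite divr_gt0 ?subr_gt0 ?exprn_gt0.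
have L : s ^+ 2 / (m1 - m0) * ln C = ln C / ((m1 - m0) / s ^+ 2).
  by field; rewrite subr_eq0 !gt_eqF.
suff H t : NP_region (normal_pdf m0 s) (normal_pdf m1 s) C t <->
    t < (m0 + m1) / 2 - s ^+ 2 / (m1 - m0) * ln C.
  by split => t /=; rewrite in_itv/=; [move/H|move=> ?; apply/H].
apply: (iff_trans (NP_region_normalE _ _ _ s0 s0 C0)).
rewrite /log_threshold mulfK// E L -ltr_pdivrMl// mulrC.
split; lra.
Qed.

Lemma completed_square m0 s0 m1 s1 t : 0 < s0 -> 0 < s1 -> s0 != s1 ->
  (t - m1) ^+ 2 / (s1 ^+ 2 *+ 2) - (t - m0) ^+ 2 / (s0 ^+ 2 *+ 2) =
  ((s1 ^+ 2 *+ 2)^-1 - (s0 ^+ 2 *+ 2)^-1) *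
    (t - (m1 * s0 ^+ 2 - m0 * s1 ^+ 2) / (s0 ^+ 2 - s1 ^+ 2)) ^+ 2 -
  (m1 - m0) ^+ 2 / ((s0 ^+ 2 - s1 ^+ 2) *+ 2).
Proof.
move=> s00 s10 s01.
have h : s0 ^+ 2 - s1 ^+ 2 != 0.
  by rewrite subr_eq0 eqrXn2 ?ltW.
field.
by rewrite h !gt_eqF.
Qed.


Lemma FPR_NP_empty (rho0 rho1 : R -> R) C :
  NP_region rho0 rho1 C = set0 -> FPR_NP rho0 rho1 C = 0.
Proof. by rewrite /FPR_NP /prob => ->; rewrite integral_set0. Qed.

Lemma prob_normal_two_tails m s a b : 0 < s -> a <= b ->
  prob (normal_pdf m s) (`]-oo, a[ `|` `]b, +oo[) =
  gauss_cdf ((a - m) / (Num.sqrt 2 * s)) +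
  gauss_cdf (- ((b - m) / (Num.sqrt 2 * s))).
Proof.
move=> s0 ab.
have d : `]-oo, a[ `&` `]b, +oo[ = set0 :> set R.
  rewrite -subset0 => t [] /=; rewrite !in_itv/= andbT => ta bt.
  by have := lt_le_trans ta (le_trans ab (ltW bt)); rewrite ltxx.
have E : (normal_prob m s (`]-oo, a[ `|` `]b, +oo[) =
    normal_prob m s `]-oo, a[ + normal_prob m s `]b, +oo[)%E.
  by rewrite measureU.
by rewrite -[LHS]/(fine (normal_prob m s _)) E normal_prob_itvNyo// normal_prob_itvoy.
Qed.

Lemma log_threshold_cvgy s0 s1 : 0 < s0 -> 0 < s1 ->
  log_threshold s0 s1 C @[C --> +oo] --> +oo.
Proof.
move=> s00 s10.
have p0 : 0 < normal_peak s0 by rewrite normal_peak_gt0// gt_eqF.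
have p1 : 0 < normal_peak s1 by rewrite normal_peak_gt0// gt_eqF.
apply/cvgryPge => A; near=> C.
have C0 : 0 < C by near: C; exact: nbhs_pinfty_gt.
rewrite /log_threshold -ler_expR lnK; last first.
  by rewrite posrE; apply: divr_gt0 => //; exact: mulr_gt0.
rewrite ler_pdivlMr// -ler_pdivrMr//.
Unshelve. all: end_near. Qed.

Lemma NP_region_normal_empty m0 s0 m1 s1 : 0 < s0 -> 0 < s1 -> s0 < s1 ->
  \forall C \near +oo,
    NP_region (normal_pdf m0 s0) (normal_pdf m1 s1) C = set0.
Proof.
move=> s00 s10 s01; near=> C.
have C0 : 0 < C by near: C; exact: nbhs_pinfty_gt.
apply/seteqP; split => // t /NP_region_normalE => /(_ s00 s10 C0).
rewrite completed_square ?lt_eqF// => H.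
have sq0 : 0 < s0 ^+ 2 by rewrite exprn_gt0.
have sq : s0 ^+ 2 < s1 ^+ 2 by rewrite ltrXn2r ?nnegrE// ltW.
have k0 : (s1 ^+ 2 *+ 2)^-1 - (s0 ^+ 2 *+ 2)^-1 <= 0.
  by rewrite subr_le0 lef_pV2 ?posrE ?mulrn_wgt0 ?lerMn2r ?(ltW sq)// (lt_trans sq0).
(* This is the maximum of the downward parabola, which the threshold eventually passes. *)
suff : - ((m1 - m0) ^+ 2 / ((s0 ^+ 2 - s1 ^+ 2) *+ 2)) <= log_threshold s0 s1 C.
  move=> H2; have := le_lt_trans H2 H; apply/negP; rewrite -leNgt gerDr.
  by rewrite mulr_le0_ge0// sqr_ge0.
near: C; have /cvgryPge := log_threshold_cvgy s00 s10; exact.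
Unshelve. all: end_near. Qed.

Lemma NP_region_normal_two_tails m0 s0 m1 s1 C r : 0 < s0 -> 0 < s1 ->
  s1 < s0 -> 0 < C -> 0 <= r ->
  log_threshold s0 s1 C + (m1 - m0) ^+ 2 / ((s0 ^+ 2 - s1 ^+ 2) *+ 2) =
    ((s1 ^+ 2 *+ 2)^-1 - (s0 ^+ 2 *+ 2)^-1) * r ^+ 2 ->
  let m := (m1 * s0 ^+ 2 - m0 * s1 ^+ 2) / (s0 ^+ 2 - s1 ^+ 2) in
  NP_region (normal_pdf m0 s0) (normal_pdf m1 s1) C =
    `]-oo, m - r[ `|` `]m + r, +oo[.
Proof.
move=> s00 s10 s10' C0 r0 rE m.
have sq1 : 0 < s1 ^+ 2 by rewrite exprn_gt0.
have sq : s1 ^+ 2 < s0 ^+ 2 by rewrite ltrXn2r ?nnegrE// ltW.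
have k0 : 0 < (s1 ^+ 2 *+ 2)^-1 - (s0 ^+ 2 *+ 2)^-1.
  by rewrite subr_gt0 ltf_pV2 ?posrE ?mulrn_wgt0 ?ltrMn2r// (lt_trans sq1).
suff H t : NP_region (normal_pdf m0 s0) (normal_pdf m1 s1) C t <->
    (t < m - r) \/ (m + r < t).
  by apply/seteqP; split => t /=; rewrite !in_itv/= andbT; [move/H|move=> ?; apply/H].
apply: (iff_trans (NP_region_normalE _ _ _ s00 s10 C0)).
rewrite completed_square ?gt_eqF// ltrBrDr rE ltr_pM2l// -/m.
rewrite -[(t - m) ^+ 2]real_normK ?num_real// ltr_pXn2r ?nnegrE// lter_normr.
by split => [/orP[]|[]] ?; [right|left|apply/orP; right|apply/orP; left]; lra.
Qed.

Lemma roc_formula_same_variance m0 m1 s T : 0 < s ->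
  roc_formula m0 s m1 s (gauss_cdf ((T - m1) / (Num.sqrt 2 * s))) =
  gauss_cdf ((T - m0) / (Num.sqrt 2 * s)).
Proof.
move=> s0; rewrite roc_formulaE divff ?gt_eqF// mul1r.
by congr gauss_cdf; rewrite -mulrBl; congr (_ / _); ring.
Qed.

Lemma cvg_normal_roc_gt m0 s0 m1 s1 : 0 < s0 -> 0 < s1 -> s1 < s0 -> m0 < m1 ->
  roc_formula m0 s0 m1 s1
      (FPR_NP (normal_pdf m0 s0) (normal_pdf m1 s1) C) /
    TPR_NP (normal_pdf m0 s0) (normal_pdf m1 s1) C @[C --> +oo] --> (1 : R).
Proof.
move=> s00 s10 s10' m01.
have sq1 : 0 < s1 ^+ 2 by rewrite exprn_gt0.
have sq : s1 ^+ 2 < s0 ^+ 2 by rewrite ltrXn2r ?nnegrE// ltW.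
set k := (s1 ^+ 2 *+ 2)^-1 - (s0 ^+ 2 *+ 2)^-1.
have k0 : 0 < k.
  by rewrite subr_gt0 ltf_pV2 ?posrE ?mulrn_wgt0 ?ltrMn2r// (lt_trans sq1).
pose m := (m1 * s0 ^+ 2 - m0 * s1 ^+ 2) / (s0 ^+ 2 - s1 ^+ 2).
have dsq : 0 < s0 ^+ 2 - s1 ^+ 2 by rewrite subr_gt0.
have mm1 : m - m1 = (m1 - m0) * s1 ^+ 2 / (s0 ^+ 2 - s1 ^+ 2).
  by rewrite /m; field; rewrite gt_eqF.
have mm1_gt0 : 0 < m - m1 by rewrite mm1 divr_gt0 ?mulr_gt0 ?subr_gt0.
have mm0_gt0 : 0 < m - m0 by lra.
have c0 : 0 < Num.sqrt (2 : R) by rewrite sqrtr_gt0.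
pose l C := log_threshold s0 s1 C + (m1 - m0) ^+ 2 / ((s0 ^+ 2 - s1 ^+ 2) *+ 2).
(* The half-width solves [l C = k * r C ^+ 2] once [l C >= 0], which holds for large [C]. *)
pose r C := Num.sqrt (l C / k).
pose u C := (m - r C - m1) / (Num.sqrt 2 * s1).
have uNy : u C @[C --> +oo] --> -oo.
  apply/cvgrNyPle => A.
  have /cvgryPge H := log_threshold_cvgy s00 s10.
  pose rA := `|m - m1 - A * (Num.sqrt 2 * s1)|.
  apply: filterS (H (k * rA ^+ 2 - (m1 - m0) ^+ 2 / ((s0 ^+ 2 - s1 ^+ 2) *+ 2))) => C.
  rewrite lerBlDr -/(l C) => lC.
  rewrite /u ler_pdivrMr ?mulr_gt0//.
  have : rA <= r C.
    have -> : rA = Num.sqrt (rA ^+ 2) by rewrite sqrtr_sqr normr_id.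
    by rewrite ler_wsqrtr// ler_pdivlMr// mulrC.
  have := ler_norm (m - m1 - A * (Num.sqrt 2 * s1)).
  rewrite -/rA; lra.
(* Normalised distance by which the right endpoint, reflected about the mean, lies beyond the left
   one. *)
have d0 : 0 < 2 * (m - m1) / (Num.sqrt 2 * s1).
  by apply: divr_gt0; apply: mulr_gt0.
have e0 : 0 < 2 * (m - m0) / (Num.sqrt 2 * s0).
  by apply: divr_gt0; apply: mulr_gt0.
have := cvg_comp _ _ uNy (cvg_roc_formula_two_tails m0 m1 s00 s10 d0 e0).
apply: cvg_trans; apply: near_eq_cvg; near=> C.
have C0 : 0 < C by near: C; exact: nbhs_pinfty_gt.
have l0 : 0 <= l C.
  rewrite -lerBlDr sub0r; near: C.
  have /cvgryPge H := log_threshold_cvgy s00 s10; exact: H.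
have rE : l C = k * r C ^+ 2.
  by rewrite sqr_sqrtr ?divr_ge0// ?(ltW k0)// mulrC divfK// gt_eqF.
have r0 : 0 <= r C by exact: sqrtr_ge0.
rewrite /FPR_NP /TPR_NP (NP_region_normal_two_tails s00 s10 s10' C0 r0 rE) -/m.
have mr : m - r C <= m + r C by lra.
rewrite !prob_normal_two_tails//=.
have E1 : - ((m + r C - m1) / (Num.sqrt 2 * s1)) =
    u C - 2 * (m - m1) / (Num.sqrt 2 * s1).
  by rewrite /u; field; rewrite !gt_eqF.
have E2 : (m - r C - m0) / (Num.sqrt 2 * s0) =
    s1 / s0 * u C - (m0 - m1) / (Num.sqrt 2 * s0).
  by rewrite /u; field; rewrite !gt_eqF.
have E3 : - ((m + r C - m0) / (Num.sqrt 2 * s0)) =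
    s1 / s0 * u C - (m0 - m1) / (Num.sqrt 2 * s0) - 2 * (m - m0) / (Num.sqrt 2 * s0).
  by rewrite /u; field; rewrite !gt_eqF.
by rewrite E1 E2 E3.
Unshelve. all: end_near. Qed.

Lemma cvg_normal_roc m0 s0 m1 s1 : 0 < s0 -> 0 < s1 -> m0 < m1 ->
  (fun C => roc_formula m0 s0 m1 s1
      (FPR_NP (normal_pdf m0 s0) (normal_pdf m1 s1) C) /
    TPR_NP (normal_pdf m0 s0) (normal_pdf m1 s1) C)
  @ within [set C | 0 < FPR_NP (normal_pdf m0 s0) (normal_pdf m1 s1) C]
      (@pinfty_nbhs R) --> (1 : R).
Proof.
move=> s00 s10 m01; case: (ltgtP s1 s0) => s01.
- by apply: cvg_within_filter; exact: cvg_normal_roc_gt.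
(* The region is eventually empty, so the restricted filter is trivial and the limit is vacuous. *)
- move=> U _; rewrite /nbhs /= /within /=.
  apply: filterS (NP_region_normal_empty m0 m1 s00 s10 s01) => C /FPR_NP_empty ->.
  by rewrite ltxx.
- apply: cvg_within_filter; apply: cvg_near_cst; near=> C.
  have C0 : 0 < C by near: C; exact: nbhs_pinfty_gt.
  rewrite s01 /FPR_NP /TPR_NP NP_region_normal_eq_variance//.
  rewrite /prob -!/(normal_prob _ _ _) !normal_prob_itvNyo//=.
  by rewrite roc_formula_same_variance// divff// gt_eqF// gauss_cdf_gt0.
Unshelve. all: end_near. Qed.

End normal_regions.

(** * Continuity in the two standard deviations *)

Section normal_continuity.
Context {R : realType}.
Implicit Types (x y m s t C : R).
Local Notation mu := (@lebesgue_measure R).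

(** Dominated convergence concerns sequences, hence this criterion; [U] confines them to a region
    where one dominating function serves. *)
Lemma seq_continuous_at {K : realType} {V W : pseudoMetricType K} (f : V -> W)
    (p : V) (U : set V) : nbhs p U ->
  (forall v : nat -> V, (forall n, U (v n)) -> v n @[n --> \oo] --> p ->
    f (v n) @[n --> \oo] --> f p) ->
  {for p, continuous f}.
Proof.
move=> Up H; apply: contrapT => nf.
have [e nE] : exists e : {posnum K}, ~ (\forall x \near p, ball (f p) e%:num (f x)).
  apply: contrapT => nE; apply: nf; apply/cvg_ballP => e e0.
  apply: contrapT => ne; apply: nE; exists (PosNum e0); exact: ne.
have [v vP] : exists v : nat -> V, forall n,
    [/\ U (v n), ball p n.+1%:R^-1 (v n) & ~ ball (f p) e%:num (f (v n))].
  suff /choice[v vP] : forall n : nat, exists x : V,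
      [/\ U x, ball p (n.+1%:R^-1 : K) x & ~ ball (f p) e%:num (f x)] by exists v.
  move=> n; apply: contrapT => nv; apply: nE.
  have nb : nbhs p (ball p (n.+1%:R^-1 : K)) by apply: nbhsx_ballx; rewrite invr_gt0.
  apply: filterS (filterI Up nb) => x [Ux bx].
  by apply: contrapT => nb'; apply: nv; exists x.
have vp : v n @[n --> \oo] --> p.
  apply/cvg_ballP => r r0.
  have : (n.+1%:R^-1 : K) @[n --> \oo] --> (0 : K) by exact: cvg_harmonic.
  move=> /cvgr_lt /(_ r r0); apply: filterS => n nr.
  have [_ + _] := vP n; apply: le_ball; exact: ltW.
have /cvg_ballP /(_ e%:num) := H v (fun n => let: And3 a _ _ := vP n in a) vp.
case=> // N _ /(_ N (leqnn N)).
by have [_ _] := vP N.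
Qed.

Lemma normal_peakE s : 0 < s -> normal_peak s = s^-1 * (Num.sqrt (pi *+ 2))^-1.
Proof.
move=> s0; rewrite /normal_peak -mulrnAr sqrtrM ?sqr_ge0// sqrtr_sqr gtr0_norm//.
by rewrite invfM.
Qed.

(** Up to a common constant the peak [1 / a] is at most [2 / s = 4 / (2 * s)], and the exponential
    factor increases with the deviation. *)
Lemma normal_pdf_envelope m s a t : 0 < s -> s / 2 < a < 2 * s ->
  normal_pdf m a t <= 4 * normal_pdf m (2 * s) t.
Proof.
move=> s0 /andP[sa as_].
have a0 : 0 < a by lra.
have s20 : 0 < 2 * s by lra.
rewrite !normal_pdfE ?gt_eqF// !normal_peakE// mulrA.
apply: ler_pM; rewrite ?expR_ge0//.
- by rewrite mulr_ge0 ?invr_ge0 ?sqrtr_ge0// ltW.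
- rewrite mulrA ler_wpM2r ?invr_ge0 ?sqrtr_ge0//.
  have -> : 4 * (2 * s)^-1 = (s / 2)^-1 by field; rewrite gt_eqF.
  by rewrite lef_pV2 ?posrE ?divr_gt0// ltW.
- rewrite /normal_fun ler_expR !mulNr lerN2 ler_wpM2l ?sqr_ge0//.
  rewrite lef_pV2 ?posrE ?mulrn_wgt0 ?exprn_gt0// lerMn2r/=.
  by rewrite lerXn2r ?nnegrE ?(ltW a0) ?(ltW s20) ?(ltW as_).
Qed.

Lemma cvg_normal_pdf m s t (a : nat -> R) : 0 < s -> (forall n, 0 < a n) ->
  a n @[n --> \oo] --> s ->
  normal_pdf m (a n) t @[n --> \oo] --> normal_pdf m s t.
Proof.
move=> s0 a0 ah.
rewrite normal_pdfE ?gt_eqF//.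
under eq_fun do rewrite normal_pdfE ?gt_eqF//.
apply: cvgM.
  rewrite normal_peakE//; under eq_fun do rewrite normal_peakE//.
  apply: cvgM; last exact: cvg_cst.
  by apply: cvgV => //; rewrite gt_eqF.
rewrite /normal_fun; apply: continuous_cvg; first exact: continuous_expR.
apply: cvgM; first exact: cvg_cst.
apply: cvgV; first by rewrite mulrn_eq0 /= expf_eq0 /= gt_eqF.
apply: cvgMn.
by apply: (cvg_comp _ (fun x => x ^+ 2)) ah _; exact: exprn_continuous.
Qed.

(** The separate law [m], [c n] serves both rates: [m0] and [a] give the true positive one, [m1] and
    [b] the false positive one. *)
Lemma cvg_prob_NP_region_normal m0 s0 m1 s1 m s C (a b c : nat -> R) :
  0 < C -> m0 != m1 -> 0 < s0 -> 0 < s1 -> 0 < s ->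
  (forall n, 0 < a n) -> (forall n, 0 < b n) -> (forall n, s / 2 < c n < 2 * s) ->
  a n @[n --> \oo] --> s0 -> b n @[n --> \oo] --> s1 -> c n @[n --> \oo] --> s ->
  prob (normal_pdf m (c n))
    (NP_region (normal_pdf m0 (a n)) (normal_pdf m1 (b n)) C) @[n --> \oo] -->
  prob (normal_pdf m s) (NP_region (normal_pdf m0 s0) (normal_pdf m1 s1) C).
Proof.
move=> C0 m01 s00 s10 s_0 a0 b0 cs ca cb cc.
have c0 n : 0 < c n by have /andP[] := cs n; lra.
pose D n := NP_region (normal_pdf m0 (a n)) (normal_pdf m1 (b n)) C.
pose D' := NP_region (normal_pdf m0 s0) (normal_pdf m1 s1) C.
pose f n := (EFin \o normal_pdf m (c n)) \_ (D n).
pose f' := (EFin \o normal_pdf m s) \_ D'.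
have mNP a' b' :
    measurable (NP_region (normal_pdf m0 a') (normal_pdf m1 b') C).
  by apply: measurable_NP_region; exact: measurable_normal_pdf.
have mpatch t0 E : measurable E ->
    measurable_fun [set: measurableTypeR R] ((EFin \o normal_pdf m t0) \_ E).
  move=> mE; apply/(measurable_restrictT _ _).1 => //.
  by apply/measurable_EFinP/measurable_funTS; exact: measurable_normal_pdf.
have tie : countable [set t | normal_pdf m0 s0 t = C * normal_pdf m1 s1 t].
  by apply: finite_set_countable; exact: normal_tie_finite.
have [] := @dominated_convergence _ (measurableTypeR R) R mu setT measurableT f f'
  (fun t => (4 * normal_pdf m (2 * s) t)%:E).
- by move=> n; apply: mpatch; exact: mNP.
- by apply: mpatch; exact: mNP.
- exists [set t | normal_pdf m0 s0 t = C * normal_pdf m1 s1 t]; split.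
  + by apply: countable_measurable => //; exact: measurable_set1.
  + exact: countable_lebesgue_measure0.
+ move=> t /= nt; apply: contrapT => tie_t; apply: nt => _.
  have la : normal_pdf m0 (a n) t @[n --> \oo] --> normal_pdf m0 s0 t.
    exact: cvg_normal_pdf.
  have lb : C * normal_pdf m1 (b n) t @[n --> \oo] --> C * normal_pdf m1 s1 t.
    by apply: cvgM; [exact: cvg_cst|exact: cvg_normal_pdf].
  have lc : (normal_pdf m (c n) t)%:E @[n --> \oo] --> (normal_pdf m s t)%:E.
    by apply: cvg_EFin; [exact: nearW|exact: cvg_normal_pdf].
  have ld : (normal_pdf m0 (a n) t - C * normal_pdf m1 (b n) t) @[n --> \oo] -->
     normal_pdf m0 s0 t - C * normal_pdf m1 s1 t by exact: cvgB.
  (* Away from ties the strict inequality persists for large [n], so membership of [t] in the region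
     is eventually constant. *)
  have [lt|lt] : C * normal_pdf m1 s1 t < normal_pdf m0 s0 t \/
      normal_pdf m0 s0 t < C * normal_pdf m1 s1 t.
    case: (ltgtP (normal_pdf m0 s0 t) (C * normal_pdf m1 s1 t)) => h; [by right|by left|by []].
  + rewrite /f' patchE mem_set//.
    apply: cvg_trans lc; apply: near_eq_cvg.
    have : 0 < normal_pdf m0 s0 t - C * normal_pdf m1 s1 t by rewrite subr_gt0.
    move=> /(cvgr_gt _ ld); apply: filterS => n.
    by rewrite subr_gt0 => h; rewrite /f patchE mem_set.
  + rewrite /f' patchE memNset; last by move/lt_trans => /(_ _ lt); rewrite ltxx.
    apply: cvg_near_cst.
    have : normal_pdf m0 s0 t - C * normal_pdf m1 s1 t < 0 by rewrite subr_lt0.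
    move=> /(cvgr_lt _ ld); apply: filterS => n.
    rewrite subr_lt0 => h; rewrite /f patchE memNset//.
    by move/lt_trans => /(_ _ h); rewrite ltxx.
- under eq_fun do rewrite EFinM.
  by apply: integrableZl => //; exact: integrable_normal_pdf.
- apply: aeW => t n _; rewrite /f patchE; case: ifPn => _.
    by rewrite gee0_abs ?lee_fin ?normal_pdf_ge0// normal_pdf_envelope.
  by rewrite abse0 lee_fin mulr_ge0// normal_pdf_ge0.
move=> _ _ H.
have H2 : (\int[mu]_(x in D n) (normal_pdf m (c n) x)%:E)%E @[n --> \oo] -->
   (\int[mu]_(x in D') (normal_pdf m s x)%:E)%E.
  rewrite [X in _ --> X]integral_mkcond.
  by under eq_fun do rewrite integral_mkcond.
have fin : (\int[mu]_(x in D') (normal_pdf m s x)%:E)%E \is a fin_num.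
  exact: (fin_num_measure (normal_prob m s) D' (mNP _ _)).
move: H2; rewrite -(fineK fin) => /fine_cvg.
exact.
Qed.

Lemma continuous_NP_normal m0 m1 C s0 s1 : 0 < C -> m0 != m1 -> 0 < s0 -> 0 < s1 ->
  {for (s0, s1), continuous (fun s : R * R =>
    (FPR_NP (normal_pdf m0 s.1) (normal_pdf m1 s.2) C,
     TPR_NP (normal_pdf m0 s.1) (normal_pdf m1 s.2) C))}.
Proof.
move=> C0 m01 s00 s10.
pose U : set (R * R) := [set s | s0 / 2 < s.1 < 2 * s0 /\ s1 / 2 < s.2 < 2 * s1].
have nearU x : 0 < x -> \forall y \near x, x / 2 < y < 2 * x.
  move=> x0; have : x \in `]x / 2, 2 * x[.
    by rewrite in_itv/=; apply/andP; split; lra.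
  by move/near_in_itvoo; apply: filterS => y; rewrite in_itv.
apply: (@seq_continuous_at R (R * R)%type (R * R)%type _ (s0, s1) U).
  exists ([set y | s0 / 2 < y < 2 * s0], [set y | s1 / 2 < y < 2 * s1]).
    by split; exact: nearU.
  by move=> [x y] [].
move=> v Uv vp.
have v1 : (v n).1 @[n --> \oo] --> s0 by apply: cvg_comp vp _; exact: cvg_fst.
have v2 : (v n).2 @[n --> \oo] --> s1 by apply: cvg_comp vp _; exact: cvg_snd.
have p1 n : 0 < (v n).1 by have [/andP[]] := Uv n; lra.
have p2 n : 0 < (v n).2 by have [_ /andP[]] := Uv n; lra.
have H1 : FPR_NP (normal_pdf m0 (v n).1) (normal_pdf m1 (v n).2) C @[n --> \oo] -->
    FPR_NP (normal_pdf m0 s0) (normal_pdf m1 s1) C.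
  by apply: cvg_prob_NP_region_normal => // n; have [] := Uv n.
have H2 : TPR_NP (normal_pdf m0 (v n).1) (normal_pdf m1 (v n).2) C @[n --> \oo] -->
    TPR_NP (normal_pdf m0 s0) (normal_pdf m1 s1) C.
  by apply: cvg_prob_NP_region_normal => // n; have [] := Uv n.
exact: (cvg_pair H1 H2).
Qed.

End normal_continuity.

(** * The common curve for equal variances *)

Section same_variance.
Context {R : realType}.
Implicit Types (m s C T : R) (p : R * R).

(** Rates of the test that cuts the transformed line at [T]; all three curves of the equal-variance
    case are identified with the range of this map. *)
Definition same_variance_point m0 m1 s T : R * R :=
  (gauss_cdf ((T - m1) / (Num.sqrt 2 * s)), gauss_cdf ((T - m0) / (Num.sqrt 2 * s))).

Lemma NP_curve_same_variance m0 m1 s : 0 < s -> m0 < m1 ->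
  [set p | exists C, 0 < C /\ p =
    (FPR_NP (normal_pdf m0 s) (normal_pdf m1 s) C,
     TPR_NP (normal_pdf m0 s) (normal_pdf m1 s) C)] =
  range (same_variance_point m0 m1 s).
Proof.
move=> s0 m01.
have E C : 0 < C -> (FPR_NP (normal_pdf m0 s) (normal_pdf m1 s) C,
    TPR_NP (normal_pdf m0 s) (normal_pdf m1 s) C) =
    same_variance_point m0 m1 s ((m0 + m1) / 2 - s ^+ 2 / (m1 - m0) * ln C).
  move=> C0; rewrite /FPR_NP /TPR_NP NP_region_normal_eq_variance//.
  by rewrite /prob -!/(normal_prob _ _ _) !normal_prob_itvNyo.
apply/seteqP; split => p.
  by move=> [C [C0 ->]]; rewrite E//; eexists.
(* This [C] solves [T = (m0 + m1) / 2 - s ^+ 2 / (m1 - m0) * ln C]. *)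
move=> [T _ <-]; exists (expR (((m0 + m1) / 2 - T) / (s ^+ 2 / (m1 - m0)))).
split; first exact: expR_gt0.
rewrite E ?expR_gt0// expRK [X in _ - X]mulrC divfK ?subKr//.
by rewrite mulf_neq0 ?invr_eq0 ?expf_neq0 ?subr_eq0 ?gt_eqF.
Qed.

Lemma formula_curve_same_variance m0 m1 s : 0 < s ->
  [set p | exists x, 0 < x < 1 /\ p = (x, roc_formula m0 s m1 s x)] =
  range (same_variance_point m0 m1 s).
Proof.
move=> s0; apply/seteqP; split => p.
  move=> [x [/gauss_cdf_surj[z <-] ->]].
  have zE : (m1 + z * (Num.sqrt 2 * s) - m1) / (Num.sqrt 2 * s) = z.
    by rewrite addrC addKr mulfK// mulf_neq0 ?gt_eqF// sqrtr_gt0.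
  exists (m1 + z * (Num.sqrt 2 * s)) => //.
  have := roc_formula_same_variance m0 m1 (m1 + z * (Num.sqrt 2 * s)) s0.
  by rewrite /same_variance_point zE => ->.
move=> [T _ <-]; exists (gauss_cdf ((T - m1) / (Num.sqrt 2 * s))).
by rewrite gauss_cdf_gt0 gauss_cdf_lt1 roc_formula_same_variance.
Qed.

End same_variance.

(** * Assembly of the three claims *)

Unset Implicit Arguments.
Set Strict Implicit.
Set Printing Implicit Defensive.

Theorem theorem2 (R : realType) (Omega : set R) (rho0 rho1 Phi : R -> R)
    (mu0 mu1 sigma0 sigma1 : R) :
  (* Omega is a (nonempty, open) connected domain of R *)
  open Omega -> connected Omega -> Omega !=set0 ->
  density_on Omega rho0 -> density_on Omega rho1 ->
  (* Phi : Omega -> R strictly increasing and differentiable *)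
  (forall x y, Omega x -> Omega y -> x < y -> Phi x < Phi y) ->
  (forall x, Omega x -> derivable Phi x 1) ->
  0 < sigma0 -> 0 < sigma1 -> mu0 < mu1 ->
  (* Phi(omega) ~ N(mu0, sigma0^2) under rho0 and ~ N(mu1, sigma1^2) under rho1 *)
  (forall B, measurable B ->
     (\int[lebesgue_measure]_(x in Omega `&` Phi @^-1` B) (rho0 x)%:E)%E
       = normal_prob mu0 sigma0 B) ->
  (forall B, measurable B ->
     (\int[lebesgue_measure]_(x in Omega `&` Phi @^-1` B) (rho1 x)%:E)%E
       = normal_prob mu1 sigma1 B) ->
  [/\
  (* (1) equal variances: both curves coincide and are the graph of the formula *)
    (sigma0 = sigma1 ->
       [set p | exists C, 0 < C /\ p = (FPR_NP rho0 rho1 C, TPR_NP rho0 rho1 C)]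
       = [set p | exists tau, 0 < FPR_cum rho1 tau < 1 /\
                     p = (FPR_cum rho1 tau, TPR_cum rho0 tau)]
     /\
       [set p | exists C, 0 < C /\ p = (FPR_NP rho0 rho1 C, TPR_NP rho0 rho1 C)]
       = [set p | exists x, 0 < x < 1 /\ p = (x, roc_formula mu0 sigma0 mu1 sigma1 x)]),
  (* (2) the NP ROC curve only depends on (mu0, sigma0, mu1, sigma1), through the
     NP ROC of the Gaussian pair, and the latter is continuous in (sigma0, sigma1) *)
    (forall C, 0 < C ->
       FPR_NP rho0 rho1 C = FPR_NP (normal_pdf mu0 sigma0) (normal_pdf mu1 sigma1) C /\
       TPR_NP rho0 rho1 C = TPR_NP (normal_pdf mu0 sigma0) (normal_pdf mu1 sigma1) C),
    (forall C, 0 < C -> forall s0 s1 : R, 0 < s0 -> 0 < s1 ->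
       {for (s0, s1), continuous (fun s : R * R =>
          (FPR_NP (normal_pdf mu0 s.1) (normal_pdf mu1 s.2) C,
           TPR_NP (normal_pdf mu0 s.1) (normal_pdf mu1 s.2) C))})
  (* (3) low-FPR asymptotic equivalence, C -> +oo (along the C where the ratio is defined) *)
  & (fun C => roc_formula mu0 sigma0 mu1 sigma1 (FPR_NP rho0 rho1 C) / TPR_NP rho0 rho1 C)
      @ within [set C | 0 < FPR_NP rho0 rho1 C] (@pinfty_nbhs R) --> (1 : R) ].
Proof.
move=> oO cO _ [mr0 r0_ge0 r0_supp _] [mr1 r1_ge0 r1_supp _] incr der.
move=> s0 s1 m01 H0 H1.
have NPE C : 0 < C ->
    FPR_NP rho0 rho1 C = FPR_NP (normal_pdf mu0 sigma0) (normal_pdf mu1 sigma1) C /\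
    TPR_NP rho0 rho1 C = TPR_NP (normal_pdf mu0 sigma0) (normal_pdf mu1 sigma1) C.
  move=> C0.
  have mD : measurable (NP_region rho0 rho1 C) by exact: measurable_NP_region.
  have DO : NP_region rho0 rho1 C `<=` Omega.
    move=> x; apply: contraPP => NOx; rewrite /NP_region /= r0_supp// r1_supp//.
    by rewrite mulr0 ltxx.
  have [B mB DE] := measurable_transport_preimage cO incr der s0 H0 mD DO.
  have fin (m s : R) : (\int[lebesgue_measure]_x (normal_pdf m s x)%:E < +oo)%E.
    by rewrite integral_normal_pdf ltry.
  have [] := integral_NP_region C0 mB (measurable_preimage_transport oO der) mr0 mr1
    (measurable_normal_pdf mu0 sigma0) (measurable_normal_pdf mu1 sigma1)
    r0_ge0 r1_ge0 (normal_pdf_ge0 mu0 sigma0) (normal_pdf_ge0 mu1 sigma1)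
    (fin _ _) (fin _ _) H0 H1 DE.
  by move=> E0 E1; rewrite /FPR_NP /TPR_NP /prob E0 E1.
split => //.
- move=> e; rewrite -e in s1 H1 NPE *.
  have -> : [set p | exists C, 0 < C /\ p = (FPR_NP rho0 rho1 C, TPR_NP rho0 rho1 C)] =
      range (same_variance_point mu0 mu1 sigma0).
    rewrite -NP_curve_same_variance//; apply/seteqP.
    by split => p [C [C0 ->]]; exists C; split => //; have [-> ->] := NPE C C0.
  rewrite formula_curve_same_variance//; split => //.
  apply/seteqP; split => p.
    move=> [T _ <-]; have [x Ox <-] := transport_surj cO incr der T s0 H0.
    exists x; rewrite /FPR_cum /TPR_cum /prob.
    have I0 := integral_transport_itvNyo incr s0 H0 r0_supp Ox.
    have I1 := integral_transport_itvNyo incr s0 H1 r1_supp Ox.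
    by rewrite I0 I1 /= gauss_cdf_gt0 gauss_cdf_lt1.
  (* A threshold outside [Omega] has false positive rate 0 or 1, which [F0] and [F1] exclude. *)
  move=> [x [/andP[F0 F1] ->]]; have [Ox|NOx] := pselect (Omega x); last first.
    have := integral_transport_itvNyo_notin cO H1 r1_supp NOx.
    move: F0 F1; rewrite /FPR_cum /prob !inE => F0 F1 /orP[] /eqP E.
      by move: F0; rewrite E ltxx.
    by move: F1; rewrite E ltxx.
  exists (Phi x) => //; rewrite /FPR_cum /TPR_cum /prob.
  have I0 := integral_transport_itvNyo incr s0 H0 r0_supp Ox.
  have I1 := integral_transport_itvNyo incr s0 H1 r1_supp Ox.
  by rewrite I0 I1.
- by move=> C C0 t0 t1 t00 t10; apply: continuous_NP_normal => //; rewrite lt_eqF.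
- move=> U /(cvg_normal_roc s0 s1 m01) HU.
  (* The identification [NPE] with the Gaussian rates is stated for [C > 0], which holds
     eventually. *)
  have C0 : \forall C \near @pinfty_nbhs R, 0 < C by exact: nbhs_pinfty_gt (num_real _).
  apply: filterS (filterI C0 HU) => C [/NPE[FE TE]] /=.
  by rewrite FE TE.
Qed.
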